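(* Consider the network with 2 CUs, 2 eRRHs and 2 CPs under an oblivious stationary randomized (OSR) policy with parameters $b_k^{(n)}$, $r_k$ ($n,k\in\{1,2\}$), and put $\zeta_{nk}=1-(1-b_k^{(n)})^2$, where $r_k\zeta_{nk}>0$ for all $n,k$. Then the average AoI of the eRRHs is $$L_e=\frac14\sum_{n=1}^{2}\sum_{k=1}^{2}\frac{\mathbb{E}[\Gamma_{nk}(l)]}{\mathbb{E}[Y_{nk}(l)]}=\frac14\sum_{n=1}^{2}\sum_{k=1}^{2}\frac{1}{r_k\zeta_{nk}}.$$
   Context: Time is slotted, $t=0,1,2,\dots$; $m,n,k\in\{1,2\}$ index content users (CUs), eRRHs and content providers (CPs). An OSR policy is given by numbers $b_k^{(n)}\in[0,1]$ with $b_k:=b_k^{(1)}+b_k^{(2)}\le 1$ and $r_1\ge r_2$ in $[0,1]$. In slot $t$, $\beta_{mk}^{(n)}(t)\in\{0,1\}$ indicates that CU $m$ sends a request for CP $k$ to eRRH $n$; $\sum_n\beta_{mk}^{(n)}(t)\le 1$ and $\Pr(\beta_{mk}^{(n)}(t)=1)=b_k^{(n)}$. $\gamma_{nk}(t)\in\{0,1\}$ with $\Pr(\gamma_{nk}(t)=1)=r_k$ is the decision of eRRH $n$ to command CP $k$ to send a new packet (effective only if eRRH $n$ received a request for CP $k$). The vectors $(\beta_{mk}^{(n)}(t))_{n}$ are independent over $m$ and over $t$; the $\gamma_{nk}(t)$ are independent over $n,k,t$ and independent of the $\beta$'s. AoI at the eRRHs: $g_{nk}(0)=1$, and $g_{nk}(t+1)=1$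 if $\gamma_{nk}(t)\sum_m\beta_{mk}^{(n)}(t)>0$, $g_{nk}(t+1)=g_{nk}(t)+1$ otherwise. The average AoI of eRRHs is $L_e=\lim_{T\to\infty}\frac1T\sum_{t=1}^T\frac14\sum_{n=1}^{2}\sum_{k=1}^{2}\mathbb{E}[g_{nk}(t)]$. $C_{nk}(l)$ is the time at which eRRH $n$ receives a new packet from CP $k$ (i.e. $g_{nk}$ is reset to 1) for the $l$-th time; $Y_{nk}(l)=C_{nk}(l+1)-C_{nk}(l)$; $\Gamma_{nk}(l)=\sum_{t=C_{nk}(l)}^{C_{nk}(l+1)-1}g_{nk}(t)$. *)

(* Defs.v *)
From HB Require Import structures.
From mathcomp Require Import all_boot all_order all_algebra.
From mathcomp Require Import all_classical all_reals all_analysis.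

Set Implicit Arguments.
Unset Strict Implicit.
Unset Printing Implicit Defensive.

Import Order.TTheory GRing.Theory Num.Theory.
Import numFieldNormedType.Exports.

Local Open Scope classical_set_scope.
Local Open Scope ring_scope.

(* The indices 1, 2 of content users (m), eRRHs (n) and content providers (k)
   are ord0 and ord_max in 'I_2. *)

Section Independence.
Context {d : measure_display} {Omega : measurableType d} {R : realType}.
Variable P : probability Omega R.

Definition generated_sigma_algebra {J : Type} {d' : measure_display}
    {S : measurableType d'} (X : J -> Omega -> S) : set_system Omega :=
  <<s [set A | exists j (B : set S), measurable B /\ A = X j @^-1` B] >>.

Definition mutually_independent {I : eqType} (F : I -> set_system Omega) :=
  forall (s : seq I) (A : I -> set Omega), uniq s ->
    (forall i, i \in s -> F i (A i)) ->
    (P (\bigcap_(i in [set` s]) A i) = \prod_(i <- s) P (A i))%E.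

Definition independent2 (F G : set_system Omega) :=
  forall A B : set Omega, F A -> G B -> (P (A `&` B) = P A * P B)%E.

End Independence.

(* b k n is the probability $b_k^{(n)}$. *)
Record osr_policy {R : realType} (b : 'I_2 -> 'I_2 -> R) (r : 'I_2 -> R)
    : Prop := OsrPolicy {
  osr_b01 : forall k n, 0 <= b k n <= 1 ;
  osr_b_sum : forall k, \sum_(n < 2) b k n <= 1 ;
  osr_r01 : forall k, 0 <= r k <= 1 ;
  osr_r_mono : r ord_max <= r ord0 }.

Definition zeta {R : realType} (b : 'I_2 -> 'I_2 -> R) (n k : 'I_2) : R :=
  1 - (1 - b k n) ^+ 2.

Section Model.
Context {d : measure_display} {Omega : measurableType d} {R : realType}.
Variable P : probability Omega R.

(* beta m k n t is $\beta_{mk}^{(n)}(t)$ and gamma n k t is $\gamma_{nk}(t)$,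
   true standing for 1. *)
Variable beta : 'I_2 -> 'I_2 -> 'I_2 -> nat -> {RV P >-> bool}.
Variable gamma : 'I_2 -> 'I_2 -> nat -> {RV P >-> bool}.

(* No independence between requests for different k is assumed. *)
Record osr_process (b : 'I_2 -> 'I_2 -> R) (r : 'I_2 -> R) : Prop :=
  OsrProcess {
  beta_sum : forall m k t w, (\sum_(n < 2) beta m k n t w <= 1)%N ;
  beta_law : forall m k n t, P [set w | beta m k n t w] = (b k n)%:E ;
  gamma_law : forall n k t, P [set w | gamma n k t w] = (r k)%:E ;
  beta_indep : forall k, mutually_independent P
    (fun mt : 'I_2 * nat =>
       generated_sigma_algebra (fun n => beta mt.1 k n mt.2)) ;
  gamma_indep : mutually_independent P
    (fun nkt : 'I_2 * 'I_2 * nat =>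
       generated_sigma_algebra (fun _ : unit => gamma nkt.1.1 nkt.1.2 nkt.2)) ;
  beta_gamma_indep : independent2 P
    (generated_sigma_algebra
       (fun mknt : 'I_2 * 'I_2 * 'I_2 * nat =>
          beta mknt.1.1.1 mknt.1.1.2 mknt.1.2 mknt.2))
    (generated_sigma_algebra
       (fun nkt : 'I_2 * 'I_2 * nat => gamma nkt.1.1 nkt.1.2 nkt.2)) }.

Variables n k : 'I_2.

Definition update (t : nat) (w : Omega) : bool :=
  (0 < gamma n k t w * \sum_(m < 2) beta m k n t w)%N.

Fixpoint aoi (t : nat) (w : Omega) : nat :=
  if t is t'.+1 then (if update t' w then 1 else (aoi t' w).+1)%N else 1%N.

(* A packet commanded in slot t is received, and the age reset, at t + 1;
   the initial value g(0) = 1 does not count as a reset. *)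
Definition reset (t : nat) (w : Omega) : bool :=
  if t is t'.+1 then update t' w else false.

(* Time of the l-th reset, l >= 1 (there is at most one such t; 0 if the l-th
   reset never happens). *)
Definition reset_time (l : nat) (w : Omega) : nat :=
  xget 0%N [set t | reset t w /\ (\sum_(s < t.+1) reset s w)%N = l].

(* The subtraction is in R: it is not truncated. *)
Definition inter_reset (l : nat) (w : Omega) : R :=
  (reset_time l.+1 w)%:R - (reset_time l w)%:R.

Definition aoi_cycle_sum (l : nat) (w : Omega) : R :=
  \sum_(reset_time l w <= t < reset_time l.+1 w) (aoi t w)%:R.

End Model.

Section AverageAoI.
Context {d : measure_display} {Omega : measurableType d} {R : realType}.
Variable P : probability Omega R.
Variable beta : 'I_2 -> 'I_2 -> 'I_2 -> nat -> {RV P >-> bool}.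
Variable gamma : 'I_2 -> 'I_2 -> nat -> {RV P >-> bool}.

Definition time_average_aoi (T : nat) : \bar R :=
  ((T%:R^-1)%:E * \sum_(1 <= t < T.+1) ((4^-1)%:E *
     \sum_(n < 2) \sum_(k < 2) 'E_P[fun w => (aoi beta gamma n k t w)%:R]))%E.

Definition average_aoi : \bar R := limn time_average_aoi.

End AverageAoI.

(* Main.v *)
(** For fixed [n] and [k] the update indicators [U_t] are independent Bernoulli
    variables of parameter [p = r_k * zeta_nk], so every functional of the
    history [U_0, ..., U_(t-1)] has an expectation obeying a one-step recursion.
    For the age it reads [E g(t+1) = 1 + (1 - p) E g(t)], whence
    [E g(t) --> 1/p] and, by Cesaro, the value of [L_e].

    Let [N_t] be the number of resets up to time [t].  Almost surely there are
    infinitely many resets, and then [C(l) <= t < C(l+1)] iff [N_t = l].  Hence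
    [Y(l) = sum_t 1(N_t = l)] and [Gamma(l) = sum_t g(t) 1(N_t = l)]; monotone
    convergence and the one-step recursions for [P(N_t = l)] and
    [E(g(t) 1(N_t = l))], summed over [t], give [E Y(l) = 1/p] and
    [E Gamma(l) = 1/p^2].  The law of [Y(l)] is never needed. *)

Require Import Defs.
From HB Require Import structures.
From mathcomp Require Import all_boot all_order all_algebra.
From mathcomp Require Import all_classical all_reals all_analysis.
From mathcomp Require Import measurable_realfun.
From mathcomp Require Import zify ring lra.

Set Implicit Arguments.
Unset Strict Implicit.
Unset Printing Implicit Defensive.

Import Order.TTheory GRing.Theory Num.Theory.
Import numFieldNormedType.Exports.

Local Open Scope classical_set_scope.
Local Open Scope ring_scope.

(** * Histories of Bernoulli trials: one-step recursions and their limits *)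

(* Expectation of [phi] over [T] independent Bernoulli([p]) trials; a history
   lists the outcomes in chronological order, oldest first. *)
Fixpoint hist_exp {R : realType} (p : R) (T : nat) (phi : seq bool -> R) : R :=
  if T is T'.+1 then
    p * hist_exp p T' (fun s => phi (rcons s true)) +
    (1 - p) * hist_exp p T' (fun s => phi (rcons s false))
  else phi [::].

Definition hist_aoi (s : seq bool) : nat :=
  foldl (fun g x => if x then 1%N else g.+1) 1%N s.

Lemma hist_aoi_rcons s x :
  hist_aoi (rcons s x) = if x then 1%N else (hist_aoi s).+1.
Proof. by rewrite /hist_aoi foldl_rcons. Qed.

Lemma count_rcons (s : seq bool) x : count id (rcons s x) = (count id s + x)%N.
Proof. by rewrite -cats1 count_cat /= addn0. Qed.

Section HistExp.
Variables (R : realType) (p : R).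

Lemma hist_expD T (f g : seq bool -> R) :
  hist_exp p T (fun s => f s + g s) = hist_exp p T f + hist_exp p T g.
Proof. by elim: T f g => //= T IH f g; rewrite !IH; ring. Qed.

Lemma hist_exp_cst T c : hist_exp p T (fun=> c) = c.
Proof. by elim: T => //= T ->; ring. Qed.

Lemma eq_hist_exp T (f g : seq bool -> R) :
  f =1 g -> hist_exp p T f = hist_exp p T g.
Proof. by move=> /funext ->. Qed.

Hypothesis p01 : 0 < p <= 1.

Lemma hist_exp_ge0 T (f : seq bool -> R) :
  (forall s, 0 <= f s) -> 0 <= hist_exp p T f.
Proof.
case/andP: p01 => p0 p1; elim: T f => //= T IH f f0.
by rewrite addr_ge0 // mulr_ge0 ?IH ?subr_ge0 // ltW.
Qed.

(** The value [cl / p] is the fixed point of [y = cl + (1 - p) * y]; as [c T <= cl], the recursion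
    keeps [x] below it. So the monotone sequence [x] converges, and passing to the limit in the
    recursion forces the fixed point. *)
Lemma cvg_affine_rec (x c : R ^nat) (cl : R) :
  x 0%N = 0 -> (forall T, x T.+1 = c T + (1 - p) * x T) ->
  nondecreasing_seq x -> nondecreasing_seq c -> c @ \oo --> cl ->
  x @ \oo --> cl / p.
Proof.
case/andP: p01 => p0 p1 x0 xS xnd cnd ccl.
have q0 : 0 <= 1 - p by rewrite subr_ge0.
have cle n : c n <= cl.
  rewrite -(cvg_lim _ ccl)//; apply: nondecreasing_cvgn_le => //.
  exact: cvgP ccl.
have cxl : x @ \oo --> limn x.
  apply: nondecreasing_is_cvgn => //; exists (cl / p) => _ [n _ <-].
  have cq : cl / p = cl + (1 - p) * (cl / p).
    by rewrite mulrBl mul1r mulrCA divff ?gt_eqF// mulr1; ring.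
  have c00 : x 0%N <= x 1%N by exact: xnd.
  elim: n => [|n IH]; last by rewrite xS cq lerD// ler_wpM2l.
  rewrite x0 divr_ge0 ?(ltW p0)// (le_trans _ (cle 0%N))//.
  by move: c00; rewrite xS x0 mulr0 addr0.
have cxS : (fun n => x n.+1) @ \oo --> limn x by rewrite cvg_shiftS.
have cxS' : (fun n => x n.+1) @ \oo --> cl + (1 - p) * limn x.
  rewrite (_ : (fun n => x n.+1) = (fun n => c n + (1 - p) * x n)); last first.
    by apply/funext => n; rewrite xS.
  by apply: cvgD => //; apply: cvgMr.
suff -> : cl / p = limn x by [].
have E : limn x = cl + (1 - p) * limn x :> R.
  rewrite -[LHS](cvg_lim (@Rhausdorff R) cxS).
  exact: cvg_lim cxS'.
apply: (mulIf (lt0r_neq0 p0)); rewrite divfK ?gt_eqF//.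
set L : R := limn x in E *; lra.
Qed.

Lemma nondecreasing_partial_sum (u : R ^nat) : (forall t, 0 <= u t) ->
  nondecreasing_seq (fun T => \sum_(0 <= t < T) u t).
Proof.
move=> u0; apply/nondecreasing_seqP => n.
by rewrite big_nat_recr//= lerDl.
Qed.

(* [occupation l t] is [P(N_t = l)], and [age_occupation l t] is
   [E(g(t) 1(N_t = l))]. *)
Definition occupation (l t : nat) : R :=
  hist_exp p t (fun s => (count id s == l)%:R).

Definition age_occupation (l t : nat) : R :=
  hist_exp p t (fun s => (hist_aoi s)%:R * (count id s == l)%:R).

Lemma occupation_ge0 l t : 0 <= occupation l t.
Proof. by apply: hist_exp_ge0 => s; case: eqP. Qed.

Lemma age_occupation_ge0 l t : 0 <= age_occupation l t.
Proof. by apply: hist_exp_ge0 => s; rewrite mulr_ge0. Qed.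

Lemma occupation0S t : occupation 0 t.+1 = (1 - p) * occupation 0 t.
Proof.
rewrite /occupation /=.
under [in X in p * X]eq_hist_exp do rewrite count_rcons addn1 /=.
under [in X in _ + X]eq_hist_exp do rewrite count_rcons addn0.
by rewrite hist_exp_cst mulr0 add0r.
Qed.

Lemma occupationSS l t :
  occupation l.+1 t.+1 = p * occupation l t + (1 - p) * occupation l.+1 t.
Proof.
rewrite /occupation /=; congr (_ * _ + _ * _); apply: eq_hist_exp => s.
  by rewrite count_rcons addn1 eqSS.
by rewrite count_rcons addn0.
Qed.

(** Condition on the last trial: a success restarts the age at 1, leaving only the weight of [l]
    earlier resets, while a failure adds 1 to the age and keeps the count. *)
Lemma age_occupationSS l t :
  age_occupation l.+1 t.+1 =
  p * occupation l t + (1 - p) * (occupation l.+1 t + age_occupation l.+1 t).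
Proof.
rewrite /occupation /age_occupation /= -hist_expD; congr (_ * _ + _ * _).
  apply: eq_hist_exp => s.
  by rewrite count_rcons addn1 eqSS hist_aoi_rcons mul1r.
apply: eq_hist_exp => s; rewrite count_rcons addn0 hist_aoi_rcons -natr1.
by rewrite mulrDl mul1r addrC.
Qed.

(** Splitting off the term at time 0 and shifting the rest gives an affine recursion for the partial
    sums. Its forcing term is 1 for [l = 0] and [p] times the previous partial sum afterwards; since
    [p * p^-1 = 1], the limit is the same for every [l]. *)
Lemma cvg_sum_occupation l :
  (fun T => \sum_(0 <= t < T) occupation l t) @ \oo --> p^-1.
Proof.
case/andP: p01 => p0 p1.
elim: l => [|l IH].
  rewrite -[p^-1]mul1r.
  apply: (@cvg_affine_rec _ (fun=> 1)) => //; last exact: cvg_cst.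
  - by rewrite big_geq.
  - move=> T; rewrite big_nat_recl// {1}/occupation /=; congr (_ + _).
    by rewrite big_distrr /=; apply: eq_bigr => t _; rewrite occupation0S.
  - exact/nondecreasing_partial_sum/occupation_ge0.
rewrite -[p^-1]mul1r -[X in X / p](divff (lt0r_neq0 p0)).
apply: (@cvg_affine_rec _
  (fun T => p * \sum_(0 <= t < T) occupation l t)) => //.
- by rewrite big_geq.
- move=> T; rewrite big_nat_recl// {1}/occupation /= add0r.
  rewrite !big_distrr /= -big_split /=.
  by apply: eq_bigr => t _; rewrite occupationSS.
- exact/nondecreasing_partial_sum/occupation_ge0.
- move=> m n mn; rewrite ler_wpM2l ?(ltW p0)//.
  exact: (nondecreasing_partial_sum (occupation_ge0 l) mn).
- exact: cvgMr.
Qed.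

(** The same shift gives a forcing term built from two occupation sums, whose limit is
    [p * p^-1 + (1 - p) * p^-1 = p^-1]; [cvg_affine_rec] then divides once more by [p]. *)
Lemma cvg_sum_age_occupation l : (1 <= l)%N ->
  (fun T => \sum_(0 <= t < T) age_occupation l t) @ \oo --> p^-1 * p^-1.
Proof.
case/andP: p01 => p0 p1; case: l => // l _.
set c := fun T => p * \sum_(0 <= t < T) occupation l t +
   (1 - p) * \sum_(0 <= t < T) occupation l.+1 t.
have cE : c @ \oo --> p * p^-1 + (1 - p) * p^-1.
  by apply: cvgD; apply: cvgMr; exact: cvg_sum_occupation.
have -> : p^-1 * p^-1 = (p * p^-1 + (1 - p) * p^-1) / p.
  by field; rewrite gt_eqF.
apply: (@cvg_affine_rec _ c) => //.
- by rewrite big_geq.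
- move=> T; rewrite big_nat_recl// {1}/age_occupation /= mulr0 add0r /c.
  rewrite !big_distrr /= -!big_split /=.
  by apply: eq_bigr => t _; rewrite age_occupationSS mulrDr addrA.
- exact/nondecreasing_partial_sum/age_occupation_ge0.
- move=> m n mn; apply: lerD.
    rewrite ler_wpM2l ?(ltW p0)//.
    exact: (nondecreasing_partial_sum (occupation_ge0 l) mn).
  rewrite ler_wpM2l ?subr_ge0//.
  exact: (nondecreasing_partial_sum (occupation_ge0 l.+1) mn).
Qed.

Definition mean_age (t : nat) : R := hist_exp p t (fun s => (hist_aoi s)%:R).

Lemma mean_ageS t : mean_age t.+1 = 1 + (1 - p) * mean_age t.
Proof.
rewrite /mean_age /=.
under [in X in p * X]eq_hist_exp do rewrite hist_aoi_rcons.
under [in X in _ + X]eq_hist_exp do rewrite hist_aoi_rcons -natr1.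
by rewrite hist_expD !hist_exp_cst; ring.
Qed.

Lemma cvg_mean_age : mean_age @ \oo --> p^-1.
Proof.
case/andP: p01 => p0 p1.
(* [cvg_affine_rec] wants a sequence starting at 0, but the mean age starts at 1. Prepending 0 is
   consistent with the recursion, as [1 + (1 - p) * 0 = 1]. *)
pose x T : R := if T is T'.+1 then mean_age T' else 0.
suff: x @ \oo --> p^-1 by rewrite -cvg_shiftS.
have xS T : x T.+1 = 1 + (1 - p) * x T.
  by case: T => [|T] /=; [rewrite /mean_age /= mulr0 addr0|rewrite mean_ageS].
rewrite -[p^-1]mul1r.
apply: (@cvg_affine_rec _ (fun=> 1)) => //; last exact: cvg_cst.
apply/nondecreasing_seqP; elim => [|n IH].
  by rewrite xS /x mulr0 addr0.
by rewrite (xS n.+1) {1}xS lerD2l ler_wpM2l ?subr_ge0.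
Qed.

End HistExp.

(** * Constant products and measurability of finite conjunctions of events *)

Lemma prode_const_seq {R : realType} {I : Type} (s : seq I) (c : R) :
  (\prod_(i <- s) c%:E = (c ^+ size s)%:E)%E.
Proof.
by elim: s => [|i s IH]; rewrite ?big_nil// big_cons IH /= exprS EFinM.
Qed.

Lemma all_set_cons {T I : Type} (E : I -> T -> bool) i s :
  [set w | all (E^~ w) (i :: s)] = [set w | E i w] `&` [set w | all (E^~ w) s].
Proof. by apply/seteqP; split=> w /= /andP. Qed.

Lemma bigcap_all {T : Type} {I : eqType} (E : I -> T -> bool) (s : seq I) :
  \bigcap_(i in [set` s]) [set w | E i w] = [set w | all (E^~ w) s].
Proof.
by apply/seteqP; split=> w /= => [h|/allP h i]; [apply/allP|exact: h].
Qed.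

Section Events.
Context {d : measure_display} {Omega : measurableType d}.

Lemma measurable_all {I : Type} (E : I -> Omega -> bool) (s : seq I) :
  (forall i, measurable [set w | E i w]) -> measurable [set w | all (E^~ w) s].
Proof.
move=> mE; elim: s => [|i s IH]; last first.
  by rewrite all_set_cons; exact: measurableI.
by rewrite (_ : [set _ | _] = setT)//; apply/seteqP; split.
Qed.

Lemma measurable_not (E : Omega -> bool) :
  measurable [set w | E w] -> measurable [set w | ~~ E w].
Proof.
move=> mE; rewrite (_ : [set _ | _] = ~` [set w | E w]).
  exact: measurableC.
by apply/seteqP; split=> w /= /negP.
Qed.

Lemma measurable_all_not {I : Type} (E : I -> Omega -> bool) (s f : seq I) :
  (forall i, measurable [set w | E i w]) ->
  measurable [set w | all (E^~ w) s && all (fun i => ~~ E i w) f].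
Proof.
move=> mE; rewrite (_ : [set _ | _] = [set w | all (E^~ w) s] `&`
    [set w | all (fun i => ~~ E i w) f]); last first.
  by apply/seteqP; split=> w /= /andP.
apply: measurableI; first exact: measurable_all.
by apply: measurable_all => i; exact: measurable_not.
Qed.

Lemma measurable_boolP (E : Omega -> bool) :
  measurable [set w | E w] <-> measurable_fun setT E.
Proof.
have EE : [set w | E w] = setT `&` E @^-1` [set true].
  by rewrite setTI; apply/seteqP; split.
split=> [mE|mE]; last by rewrite EE; exact: mE.
by apply: (measurable_fun_bool true); rewrite -EE.
Qed.

End Events.

(** * Product formula for successes and failures together *)

Section IndependentTrials.
Context {d : measure_display} {Omega : measurableType d} {R : realType}.
Variable P : probability Omega R.

(* Product formulas on the intersections of the [E i] alone already determine
   those involving complements, which are removed one at a time. *)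
Lemma probability_all_not {I : eqType} (E : I -> Omega -> bool) (c : R) :
  (forall i, measurable [set w | E i w]) ->
  (forall s, uniq s -> P [set w | all (E^~ w) s] = (c ^+ size s)%:E) ->
  forall s f, uniq (s ++ f) ->
  P [set w | all (E^~ w) s && all (fun i => ~~ E i w) f] =
    (c ^+ size s * (1 - c) ^+ size f)%:E.
Proof.
move=> mE PE s f; elim: f s => [|i f IH] s.
  rewrite cats0 => /PE; rewrite mulr1 => <-; congr (P _).
  by apply/seteqP; split=> w /=; rewrite andbT.
rewrite uniq_catC /= mem_cat negb_or => /andP[/andP[if_ is_]].
rewrite uniq_catC => usf.
(* The event where [i] fails is the event ignoring [i] minus the one where [i] succeeds; the
   induction hypothesis covers both. *)
rewrite (_ : [set _ | _] =
   [set w | all (E^~ w) s && all (fun i => ~~ E i w) f] `\`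
   [set w | all (E^~ w) (i :: s) && all (fun i => ~~ E i w) f]); last first.
  apply/seteqP; split=> w /=.
    by move=> /and3P[-> /negPf -> ->].
  by move=> [/andP[-> ->]]; case: (E i w).
have mA u : measurable [set w | all (E^~ w) u && all (fun i => ~~ E i w) f].
  exact: measurable_all_not.
rewrite measureD ?mA// ?ltey_eq ?fin_num_measure//.
rewrite setIidr; last by move=> w /= /andP[/andP[_ ->] ->].
have uisf : uniq ((i :: s) ++ f) by rewrite /= mem_cat negb_or is_ if_.
apply: (etrans (congr2 (fun x y => x - y)%E (IH s usf) (IH (i :: s) uisf))).
by rewrite -EFinB !exprS; congr (_%:E); ring.
Qed.

End IndependentTrials.

(** * The updates of one eRRH and CP as independent trials *)

Section Updates.
Context {d : measure_display} {Omega : measurableType d} {R : realType}.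
Variable P : probability Omega R.
Variables (b : 'I_2 -> 'I_2 -> R) (r : 'I_2 -> R).
Variable beta : 'I_2 -> 'I_2 -> 'I_2 -> nat -> {RV P >-> bool}.
Variable gamma : 'I_2 -> 'I_2 -> nat -> {RV P >-> bool}.
Hypothesis hprocess : osr_process beta gamma b r.
Variables n k : 'I_2.

(** Written as a negated conjunction, because the absence of a request is an intersection of events
    independent over the CUs. *)
Definition request (t : nat) (w : Omega) : bool :=
  ~~ all (fun m => ~~ beta m k n t w) (enum 'I_2).

Lemma updateE t w : update beta gamma n k t w = gamma n k t w && request t w.
Proof.
rewrite /update /request muln_gt0 lt0b; congr (_ && _).
rewrite lt0n sum_nat_eq0; congr (~~ _).
apply/forallP/allP => [h m _|h m].
  by have /implyP/(_ isT) := h m; rewrite eqb0.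
by apply/implyP => _; rewrite eqb0 h ?mem_enum.
Qed.

Lemma measurable_RV (X : {RV P >-> bool}) : measurable [set w | X w].
Proof.
rewrite (_ : [set _ | _] = X @^-1` [set true]).
  by rewrite -[X in measurable X]setTI; exact: measurable_funP.
by apply/seteqP; split.
Qed.

Lemma generated_event {J : Type} (X : J -> {RV P >-> bool}) j :
  generated_sigma_algebra (fun j => X j) [set w | X j w].
Proof.
by apply: sub_sigma_algebra; exists j, [set true]; split.
Qed.

Lemma measurable_request t : measurable [set w | request t w].
Proof.
apply: measurable_not; apply: measurable_all => m.
by apply: measurable_not; exact: measurable_RV.
Qed.

Lemma probability_all_gamma (s : seq nat) : uniq s ->
  P [set w | all (fun t => gamma n k t w) s] = (r k ^+ size s)%:E.
Proof.
move=> us; pose f t : 'I_2 * 'I_2 * nat := (n, k, t).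
have uf : uniq (map f s) by rewrite map_inj_uniq// => t u [].
have := gamma_indep hprocess
  (A := fun i => [set w | gamma i.1.1 i.1.2 i.2 w]) uf.
rewrite bigcap_all big_map; under eq_set do rewrite all_map /=.
move=> ->; last first.
  move=> i _.
  exact: (@generated_event unit (fun=> gamma i.1.1 i.1.2 i.2) tt).
rewrite -prode_const_seq; apply: eq_bigr => t _.
exact: (gamma_law hprocess).
Qed.

Lemma probability_no_request (s : seq nat) : uniq s ->
  P [set w | all (fun t => ~~ request t w) s] =
    (((1 - b k n) ^+ 2) ^+ size s)%:E.
Proof.
(* Independence of the requests is indexed by pairs (CU, slot), so the nested conjunction is
   flattened to one over [s2]. *)
move=> us; pose s2 := [seq (m, t) | t <- s, m <- enum 'I_2].
have us2 : uniq s2.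
  apply: allpairs_uniq => //; first exact: enum_uniq.
  by move=> [x1 x2] [y1 y2] _ _ /= [-> ->].
have := beta_indep hprocess (k := k)
  (A := fun i => [set w | ~~ beta i.1 k n i.2 w]) us2.
rewrite bigcap_all big_allpairs_dep.
rewrite (_ : [set w | all _ s2] =
    [set w | all (fun t => ~~ request t w) s]); last first.
  apply/seteqP; split=> w /= /allP h; apply/allP.
    move=> t ts; rewrite negbK; apply/allP => m mm.
    by apply: (h (m, t)); apply/allpairsP; exists (t, m).
  move=> _ /allpairsP[[t m] /= [ts mm ->]] /=.
  by have := h _ ts; rewrite negbK => /allP; apply.
move=> ->; last first.
  move=> i _.
  have := @generated_event _ (fun n' => beta i.1 k n' i.2) n.
  by move=> /sigma_algebraC; congr (_ _); apply/seteqP; split=> w /= /negP.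
rewrite -prode_const_seq; apply: eq_bigr => t _.
rewrite [RHS](_ : _ = ((1 - b k n) ^+ size (enum 'I_2))%:E); last first.
  by rewrite size_enum_ord.
rewrite -prode_const_seq; apply: eq_bigr => m _ /=.
rewrite (_ : [set w | _] = ~` [set w | beta m k n t w]); last first.
  by apply/seteqP; split=> w /= /negP.
rewrite probability_setC; last exact: measurable_RV.
by rewrite EFinB; congr (_ - _)%E; exact: (beta_law hprocess).
Qed.

(** Take the absence of a request as the trial, of probability [(1 - b k n) ^+ 2], and ask for
    failures only: each contributes a factor [zeta b n k]. *)
Lemma probability_all_request (s : seq nat) : uniq s ->
  P [set w | all (fun t => request t w) s] = (zeta b n k ^+ size s)%:E.
Proof.
move=> us.
have := @probability_all_not _ _ _ P nat (fun t w => ~~ request t w)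
  ((1 - b k n) ^+ 2) _ probability_no_request [::] s us.
rewrite mul1r => <-; last first.
  by move=> t; apply: measurable_not; exact: measurable_request.
by congr (P _); apply/seteqP; split=> w /=; rewrite (eq_all (fun=> negbK _)).
Qed.

Lemma measurable_update t : measurable [set w | update beta gamma n k t w].
Proof.
rewrite (_ : [set _ | _] = [set w | gamma n k t w] `&` [set w | request t w]).
  by apply: measurableI; [exact: measurable_RV|exact: measurable_request].
by apply/seteqP; split=> w /=; rewrite updateE => /andP.
Qed.

(** The event splits into one about requests and one about commands, which lie in two independent
    sigma-algebras. *)
Lemma probability_all_update (s : seq nat) : uniq s ->
  P [set w | all (fun t => update beta gamma n k t w) s] =
    ((r k * zeta b n k) ^+ size s)%:E.
Proof.
move=> us; rewrite exprMn EFinM muleC.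
rewrite (_ : [set _ | _] = [set w | all (request^~ w) s] `&`
    [set w | all (fun t => gamma n k t w) s]); last first.
  apply/seteqP; split=> w /=.
    move=> h; apply/andP; rewrite -all_predI.
    by apply: sub_all h => t /=; rewrite updateE andbC.
  by move/andP; rewrite -all_predI; apply: sub_all => t /=; rewrite updateE andbC.
rewrite -(probability_all_gamma us) -(probability_all_request us).
apply: (beta_gamma_indep hprocess).
  (* [G] generates the sigma-algebra of the requests. Taking that sigma-algebra as the measurable
     structure on [Omega] lets the closure lemmas for [all] and negation prove membership in it. *)
  pose G := [set A : set Omega | exists j (B : set bool), measurable B /\
    A = (fun mknt : 'I_2 * 'I_2 * 'I_2 * nat =>
          beta mknt.1.1.1 mknt.1.1.2 mknt.1.2 mknt.2 : Omega -> bool) j @^-1` B].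
  apply: (@measurable_all _ (g_sigma_algebraType G)) => t.
  apply: (@measurable_not _ (g_sigma_algebraType G)).
  apply: (@measurable_all _ (g_sigma_algebraType G)) => m.
  apply: (@measurable_not _ (g_sigma_algebraType G)).
  exact: (@generated_event _ (fun mknt : 'I_2 * 'I_2 * 'I_2 * nat =>
          beta mknt.1.1.1 mknt.1.1.2 mknt.1.2 mknt.2) (m, k, n, t)).
pose G := [set A : set Omega | exists j (B : set bool), measurable B /\
    A = (fun nkt : 'I_2 * 'I_2 * nat =>
          gamma nkt.1.1 nkt.1.2 nkt.2 : Omega -> bool) j @^-1` B].
apply: (@measurable_all _ (g_sigma_algebraType G)) => t.
exact: (@generated_event _ (fun nkt : 'I_2 * 'I_2 * nat =>
          gamma nkt.1.1 nkt.1.2 nkt.2) (n, k, t)).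
Qed.

End Updates.

(** * Integrals of functionals of the history, and recurrence of successes *)

Section HistoryExpectation.
Context {d : measure_display} {Omega : measurableType d} {R : realType}.
Variable P : probability Omega R.
Variables (U : nat -> Omega -> bool) (p : R).
Hypothesis p01 : 0 < p <= 1.
Hypothesis mU : forall t, measurable [set w | U t w].
Hypothesis PU : forall s f, uniq (s ++ f) ->
  P [set w | all (U^~ w) s && all (fun t => ~~ U t w) f] =
    (p ^+ size s * (1 - p) ^+ size f)%:E.

(** Branching on the last trial reduces [T.+1] to two instances of [T], so only the events [U t]
    have to be measurable and [seq bool] carries no measurable structure. *)
Lemma measurable_history {d' : measure_display} {S : measurableType d'} T
    (phi : seq bool -> S) :
  measurable_fun setT (fun w => phi (mkseq (U^~ w) T)).
Proof.
elim: T phi => [|T IH] phi; first exact: (@measurable_cst _ _ _ _ _ (phi [::])).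
rewrite (_ : (fun _ => _) = (fun w => if U T w
   then phi (rcons (mkseq (U^~ w) T) true)
   else phi (rcons (mkseq (U^~ w) T) false))); last first.
  by apply/funext => w; rewrite mkseqS; case: (U T w).
apply: measurable_fun_ifT; first exact/measurable_boolP.
  exact: (IH (fun s => phi (rcons s true))).
exact: (IH (fun s => phi (rcons s false))).
Qed.

(* Fixing the outcomes of the later trials in [s] and [f] is what makes the
   induction on [T] go through. *)
Lemma integral_history_pattern T (phi : seq bool -> R) (s f : seq nat) :
  (forall h, 0 <= phi h) -> uniq (s ++ f) -> all (leq T) (s ++ f) ->
  (\int[P]_w (phi (mkseq (U^~ w) T) *
      (all (U^~ w) s && all (fun t => ~~ U t w) f)%:R)%:E =
   (hist_exp p T phi * (p ^+ size s * (1 - p) ^+ size f))%:E)%E.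
Proof.
move=> + + Tsf; elim: T phi s f Tsf => [|T IH] phi s f Tsf phi0 usf.
  pose A := [set w | all (U^~ w) s && all (fun t => ~~ U t w) f].
  have mA : measurable A by exact: measurable_all_not.
  rewrite EFinM -PU// -/A -[in RHS](setIT A).
  rewrite -integral_indic// -ge0_integralZl//.
  - apply: eq_integral => w _; rewrite EFinM indicE.
    congr (_ * (nat_of_bool _)%:R%:E)%E.
    by apply/idP/idP; rewrite inE.
  - exact/measurable_EFinP/measurable_indic.
  - by rewrite lee_fin; exact: phi0.
(* All indices in [s] and [f] exceed [T], so trial [T] can join either list without repetition. *)
have fresh : T \notin s ++ f.
  by apply/negP => Tin; have := allP Tsf _ Tin; rewrite ltnn.
have Tsf' : all (leq T) (s ++ f) by apply: sub_all Tsf => t /ltnW.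
have u1 : uniq ((T :: s) ++ f) by rewrite /= fresh.
have u2 : uniq (s ++ T :: f).
  by rewrite uniq_catC /= mem_cat orbC -mem_cat fresh uniq_catC.
(* Split on the outcome of trial [T]: a success moves [T] into [s], a failure into [f]. *)
under eq_integral => w _.
  rewrite (_ : (_ * _)%:E =
    ((phi (rcons (mkseq (U^~ w) T) true) *
      (all (U^~ w) (T :: s) && all (fun t => ~~ U t w) f)%:R)%:E +
     (phi (rcons (mkseq (U^~ w) T) false) *
      (all (U^~ w) s && all (fun t => ~~ U t w) (T :: f))%:R)%:E)%E); last first.
    rewrite -EFinD mkseqS /=; case: (U T w) => /=.
      by rewrite andbF mulr0 addr0.
    by rewrite mulr0 add0r.
  over.
have mI (psi : seq bool -> R) u v : measurable_fun setT (fun w =>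
    (psi (mkseq (U^~ w) T) *
      (all (U^~ w) u && all (fun t => ~~ U t w) v)%:R)%:E).
  apply/measurable_EFinP; apply: measurable_funM.
    exact: measurable_history.
  apply: measurableT_comp => //.
  exact/measurable_boolP/measurable_all_not.
rewrite ge0_integralD//.
- rewrite (IH (fun h => phi (rcons h true)))//; last by rewrite /= leqnn.
  rewrite (IH (fun h => phi (rcons h false)))//; last first.
    by rewrite all_cat /= leqnn -all_cat.
  by rewrite -EFinD /= !exprS; congr (_%:E); ring.
- by move=> w _; rewrite lee_fin mulr_ge0.
- exact: (mI (fun h => phi (rcons h true))).
- by move=> w _; rewrite lee_fin mulr_ge0.
- exact: (mI (fun h => phi (rcons h false))).
Qed.

Lemma integral_history T (phi : seq bool -> R) : (forall h, 0 <= phi h) ->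
  (\int[P]_w (phi (mkseq (U^~ w) T))%:E = (hist_exp p T phi)%:E)%E.
Proof.
move=> phi0; have := @integral_history_pattern T phi [::] [::] phi0 isT isT.
by rewrite !mulr1 => <-; apply: eq_integral => w _; rewrite mulr1.
Qed.

(** For each [T], the absence of successes from [T] on has probability at most [(1 - p) ^+ N] for
    every [N], hence 0; a countable union over [T] remains negligible. *)
Lemma negligible_finitely_often :
  P.-negligible [set w | exists T, forall t, (T <= t)%N -> ~~ U t w].
Proof.
case/andP: p01 => p0 p1.
rewrite (_ : [set _ | _] =
    \bigcup_T [set w | forall t, (T <= t)%N -> ~~ U t w]); last first.
  by apply/seteqP; split=> w /= [T]; [exists T|exists T].
apply: negligible_bigcup => T.
pose A := \bigcap_N
  [set w | all (U^~ w) [::] && all (fun t => ~~ U t w) (iota T N)].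
have mA : measurable A.
  by apply: bigcapT_measurable => N; exact: measurable_all_not.
exists A; split => //; last first.
  move=> w /= h N _ /=; apply/allP => t.
  by rewrite mem_iota => /andP[? _]; exact: h.
have PA N : (P A <= ((1 - p) ^+ N)%:E)%E.
  have := @PU [::] (iota T N) (iota_uniq _ _).
  rewrite mul1r size_iota => <-.
  apply: le_measure; rewrite ?inE //; last by move=> w /(_ N I).
  exact: measurable_all_not.
have q1 : `|1 - p| < 1 by rewrite ger0_norm ?subr_ge0// ltrBlDr ltrDl.
apply/eqP; rewrite eq_le measure_ge0 andbT.
have q_cvg : (fun N => ((1 - p) ^+ N)%:E) @ \oo --> (0%:E : \bar R).
  by apply: cvg_EFin; [exact: nearW|exact: cvg_expr].
rewrite -[leRHS](cvg_lim (@ereal_hausdorff R) q_cvg).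
apply: lime_ge; last exact: nearW.
by apply/cvg_ex; exists 0%:E.
Qed.

End HistoryExpectation.

(** * Pathwise relation between reset times and reset counts *)

Section Paths.
Context {d : measure_display} {Omega : measurableType d} {R : realType}.
Variable P : probability Omega R.
Variable beta : 'I_2 -> 'I_2 -> 'I_2 -> nat -> {RV P >-> bool}.
Variable gamma : 'I_2 -> 'I_2 -> nat -> {RV P >-> bool}.
Variables n k : 'I_2.

Local Notation U := (update beta gamma n k).
Local Notation N t w := (count id (mkseq (U^~ w) t)).
Local Notation C := (reset_time beta gamma n k).

Lemma aoiE t w : aoi beta gamma n k t w = hist_aoi (mkseq (U^~ w) t).
Proof. by elim: t => // t IH; rewrite mkseqS hist_aoi_rcons -IH. Qed.

Lemma resetE t w : reset beta gamma n k t w = last false (mkseq (U^~ w) t).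
Proof. by case: t => // t; rewrite mkseqS last_rcons. Qed.

Lemma reset_countS t w : N t.+1 w = (N t w + U t w)%N.
Proof. by rewrite mkseqS count_rcons. Qed.

Lemma reset_countE t w :
  (\sum_(s < t.+1) reset beta gamma n k s w)%N = N t w.
Proof.
elim: t => [|t IH]; first by rewrite big_ord_recr big_ord0.
by rewrite big_ord_recr reset_countS; congr (_ + _)%N.
Qed.

Lemma reset_count_homo w : {homo (fun t => N t w) : s t / (s <= t)%N}.
Proof.
apply: homo_leq => [//|s t u|t]; first exact: leq_trans.
by rewrite reset_countS leq_addr.
Qed.

(** A function of the history alone, as [measurable_history] requires. The default [false] of [last]
    reflects that time 0 is not a reset. *)
Definition reset_at l t w := last false (mkseq (U^~ w) t) && (N t w == l).

Lemma reset_atS l t w : reset_at l t.+1 w = U t w && (N t w + U t w == l)%N.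
Proof. by rewrite /reset_at reset_countS mkseqS last_rcons. Qed.

Lemma reset_time_set l w :
  [set t | reset beta gamma n k t w /\
    (\sum_(s < t.+1) reset beta gamma n k s w)%N = l] =
  [set t | reset_at l t w].
Proof.
apply/seteqP; split=> t /=; rewrite resetE reset_countE /reset_at.
  by move=> [-> ->]; rewrite eqxx.
by move=> /andP[-> /eqP].
Qed.

(** The count is nondecreasing and grows by 1 at the later of two resets, so the two counts cannot
    agree. *)
Lemma reset_at_inj l t t' w : reset_at l t w -> reset_at l t' w -> t = t'.
Proof.
wlog tt' : t t' / (t < t')%N.
  move=> H h h'; case: (ltngtP t t') => // tt'; first exact: H.
  by apply/esym; exact: H.
case: t' tt' => // t'; rewrite ltnS => /(reset_count_homo w) le.
rewrite reset_atS => /andP[_ /eqP Nt] /andP[-> /eqP Nt'].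
by move: le; rewrite Nt -Nt' addn1 ltnn.
Qed.

Lemma reset_time_at l t w : reset_at l t w -> C l w = t.
Proof.
move=> h; rewrite /reset_time reset_time_set.
by apply: xget_unique => // t' h'; exact: reset_at_inj h' h.
Qed.

Lemma reset_time_none l w : (forall t, ~~ reset_at l t w) -> C l w = 0%N.
Proof.
by move=> h; rewrite /reset_time reset_time_set xgetPN// => t /=; apply/negP.
Qed.

Lemma reset_time_leq l w : (1 <= l)%N -> (exists t, l <= N t w)%N ->
  forall t, (C l w <= t)%N = (l <= N t w)%N.
Proof.
move=> l1 ex; case: (ex_minnP ex) => m lm m_min t.
(* The count moves by at most 1, so at the first time [m] when it reaches [l] it equals [l] and a
   reset has just occurred; [1 <= l] rules out [m = 0]. *)
have -> : C l w = m.
  apply: reset_time_at; case: m lm m_min => [|m]; first by rewrite leqNgt l1.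
  move=> lm m_min; have Nm : (N m w < l)%N.
    by rewrite ltnNge; apply/negP => /m_min; rewrite ltnn.
  move: lm; rewrite reset_atS reset_countS; move: Nm.
  by case: (U m w) => /=; lia.
by apply/idP/idP => [/(reset_count_homo w)|/m_min//]; exact: leq_trans.
Qed.

Lemma unbounded_reset_count w :
  (forall T, exists2 t, (T <= t)%N & U t w) ->
  forall l, exists t, (l <= N t w)%N.
Proof.
move=> io; elim=> [|l [t lt]]; first by exists 0%N.
have [t' tt' Ut'] := io t; exists t'.+1.
by rewrite reset_countS Ut' addn1 ltnS (leq_trans lt)// reset_count_homo.
Qed.

(** By [reset_time_leq], the two bounds on [t] say that the count is at least [l] and less than
    [l.+1]. *)
Lemma reset_time_window l w : (1 <= l)%N ->
  (forall T, exists2 t, (T <= t)%N & U t w) ->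
  forall t, ((C l w <= t) && (t < C l.+1 w))%N = (N t w == l).
Proof.
move=> l1 /unbounded_reset_count ex t.
by rewrite ltnNge !reset_time_leq// -leqNgt eqn_leq andbC.
Qed.

Lemma reset_time_le_next l w : (1 <= l)%N ->
  (forall T, exists2 t, (T <= t)%N & U t w) -> (C l w <= C l.+1 w)%N.
Proof.
move=> l1 /unbounded_reset_count ex; rewrite reset_time_leq//.
by rewrite (@leq_trans l.+1)// -reset_time_leq.
Qed.

End Paths.

(** * Measurability of reset times and of sums between random bounds *)

Lemma big_nat_window {R : pzSemiRingType} (v : nat -> R) (a b T : nat) :
  (b <= T)%N ->
  \sum_(a <= t < b) v t = \sum_(0 <= t < T) v t * ((a <= t) && (t < b))%N%:R.
Proof.
move=> bT; rewrite (big_nat_widen _ _ _ _ _ bT) big_mkcond/=.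
rewrite (big_nat_widenl _ 0%N)//= big_mkcond/=; apply: eq_bigr => t _.
by case: (a <= t)%N; case: (t < b)%N; rewrite ?mulr1 ?mulr0.
Qed.

Section MeasurableCycles.
Context {d : measure_display} {Omega : measurableType d} {R : realType}.

Lemma measurable_fun_nat (f : Omega -> nat) :
  (forall c, measurable [set w | f w = c]) -> measurable_fun setT f.
Proof.
move=> mf _ Y _; rewrite setTI.
rewrite (_ : f @^-1` Y = \bigcup_(c in Y) [set w | f w = c]).
  by apply: bigcup_measurable => c _.
by apply/seteqP; split=> w /=; [exists (f w)|move=> [c Yc /= ->]].
Qed.

Lemma measurable_sum_window (a b : Omega -> nat) (v : nat -> Omega -> R) :
  measurable_fun setT a -> measurable_fun setT b ->
  (forall t, measurable_fun setT (v t)) ->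
  measurable_fun setT (fun w => \sum_(a w <= t < b w) v t w).
Proof.
move=> ma mb mv.
(* With indicators in place of random bounds, the sums up to a fixed [T] are measurable; at each [w]
   they are constant once [T >= b w]. *)
apply: (@measurable_fun_cvg _ _ _ _ (fun T w =>
  \sum_(0 <= t < T) v t w * ((a w <= t) && (t < b w))%N%:R)).
  move=> T; apply: measurable_sum => t; apply: measurable_funM => //.
  apply: measurableT_comp => //; apply: measurable_and.
    exact: measurable_fun_leq.
  exact: measurable_fun_ltn.
move=> w _; apply: cvg_near_cst; exists (b w) => // T /= bT.
by rewrite -big_nat_window.
Qed.

Variable P : probability Omega R.
Variable beta : 'I_2 -> 'I_2 -> 'I_2 -> nat -> {RV P >-> bool}.
Variable gamma : 'I_2 -> 'I_2 -> nat -> {RV P >-> bool}.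
Variables n k : 'I_2.
Hypothesis mU : forall t, measurable [set w | update beta gamma n k t w].

Lemma measurable_reset_time l :
  measurable_fun setT (reset_time beta gamma n k l).
Proof.
apply: measurable_fun_nat => c.
have mat t : measurable [set w | reset_at beta gamma n k l t w].
  apply/measurable_boolP.
  exact: (measurable_history mU t (fun h => last false h && (count id h == l))).
(* [reset_time] defaults to 0, so its fibre over 0 also contains the paths on which the [l]-th reset
   never happens. *)
pose never := \bigcap_t ~` [set w | reset_at beta gamma n k l t w].
have mnever : measurable never.
  by apply: bigcapT_measurable => t; exact: measurableC.
rewrite (_ : [set _ | _] = [set w | reset_at beta gamma n k l c w] `|`
  (if c == 0%N then never else set0)); last first.
  apply/seteqP; split=> w /=.
    have [[t at_t]|none] := pselect (exists t, reset_at beta gamma n k l t w).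
      by rewrite (reset_time_at at_t) => <-; left.
    have none' t : ~~ reset_at beta gamma n k l t w.
      by apply/negP => ?; apply: none; exists t.
    rewrite reset_time_none// => <-; right; rewrite eqxx => t _ /=.
    exact/negP.
  case; first exact: reset_time_at.
  case: eqP => // -> nv; apply: reset_time_none => t; apply/negP.
  exact: (nv t).
by apply: measurableU => //; case: ifP.
Qed.

End MeasurableCycles.

(** * Expectations of the cycle quantities and of the age *)

Section MeanAge.
Context {d : measure_display} {Omega : measurableType d} {R : realType}.
Variable P : probability Omega R.
Variables (b : 'I_2 -> 'I_2 -> R) (r : 'I_2 -> R).
Variable beta : 'I_2 -> 'I_2 -> 'I_2 -> nat -> {RV P >-> bool}.
Variable gamma : 'I_2 -> 'I_2 -> nat -> {RV P >-> bool}.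
Hypothesis hpolicy : osr_policy b r.
Hypothesis hprocess : osr_process beta gamma b r.
Variables n k : 'I_2.
Hypothesis p_gt0 : 0 < r k * zeta b n k.

Local Notation p := (r k * zeta b n k).
Local Notation U := (update beta gamma n k).
Local Notation C := (reset_time beta gamma n k).

Lemma update_probability01 : 0 < p <= 1.
Proof.
rewrite p_gt0 /=; have /andP[r0 r1] := osr_r01 hpolicy k.
rewrite (le_trans _ r1)// ler_piMr// /zeta.
by rewrite lerBlDr lerDl sqr_ge0.
Qed.

Let mU t : measurable [set w | U t w].
Proof. exact: measurable_update. Qed.

Let PU s f : uniq (s ++ f) ->
  P [set w | all (U^~ w) s && all (fun t => ~~ U t w) f] =
    (p ^+ size s * (1 - p) ^+ size f)%:E.
Proof.
apply: probability_all_not => // u uu.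
exact: (probability_all_update hprocess).
Qed.

(** Common computation for the cycle length ([psi] constantly 1) and the cycle sum ([psi] the age):
    almost surely the sum over a cycle is the series of [psi] weighted by the indicator that the
    count is [l], which is integrated term by term. *)
Lemma expectation_cycle (l : nat) (psi : seq bool -> R) (X : Omega -> R)
    (L : R) :
  (1 <= l)%N -> (forall h, 0 <= psi h) -> measurable_fun setT X ->
  (forall w, (forall T, exists2 t, (T <= t)%N & U t w) ->
     X w = \sum_(C l w <= t < C l.+1 w) psi (mkseq (U^~ w) t)) ->
  (fun T => \sum_(0 <= t < T)
     hist_exp p t (fun h => psi h * (count id h == l)%:R)) @ \oo --> L ->
  ('E_P[X] = L%:E)%E.
Proof.
move=> l1 psi0 mX XE cL; rewrite unlock.
pose g (h : seq bool) : R := psi h * (count id h == l)%:R.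
have g0 h : 0 <= g h by rewrite mulr_ge0.
have mg t : measurable_fun setT (fun w => (g (mkseq (U^~ w) t))%:E).
  apply/measurable_EFinP; exact: (measurable_history mU t g).
transitivity (\int[P]_w (\sum_(0 <= t <oo) (g (mkseq (U^~ w) t))%:E))%E.
  apply: ae_eq_integral => //.
  - exact/measurable_EFinP.
  - by apply: ge0_emeasurable_sum => // t w _ _; rewrite lee_fin.
  apply: negligibleS (negligible_finitely_often update_probability01 mU PU).
  move=> w /= neq; apply: contrapT => io; apply: neq => _.
  have {}io T : exists2 t, (T <= t)%N & U t w.
    apply: contrapT => h; apply: io; exists T => t Tt; apply/negP => Ut.
    by apply: h; exists t.
  (* The partial sums of the series are constant from [C l.+1 w] on, since no later term has count
     [l]. *)
  rewrite XE//; apply/esym/lim_near_cst => //.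
  exists (C l.+1 w) => // T /= CT; rewrite sumEFin; congr (_%:E).
  rewrite (big_nat_window _ _ CT); apply: eq_bigr => t _.
  by rewrite reset_time_window.
rewrite integral_nneseries//; last by move=> t w _; rewrite lee_fin.
apply/cvg_lim => //.
under eq_fun do under eq_bigr do rewrite (integral_history mU PU)//.
apply: cvg_EFin; first by apply: nearW => T; rewrite sumEFin.
by under eq_fun do rewrite /= sumEFin.
Qed.

Lemma expectation_inter_reset l : (1 <= l)%N ->
  ('E_P[inter_reset beta gamma n k l] = (p^-1)%:E)%E.
Proof.
move=> l1; apply: (@expectation_cycle l (fun=> 1)) => //.
- apply: measurable_funB; apply: measurableT_comp => //;
    exact: measurable_reset_time.
(* Since [C l w <= C l.+1 w] on such paths, the truncated difference counting the terms agrees with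
   the real one. *)
- move=> w io; rewrite sumr_const_nat natrB//.
  exact: reset_time_le_next.
- under eq_fun do under eq_bigr do under eq_hist_exp do rewrite mul1r.
  exact: (cvg_sum_occupation update_probability01 l).
Qed.

Lemma expectation_aoi_cycle_sum l : (1 <= l)%N ->
  ('E_P[aoi_cycle_sum beta gamma n k l] = (p^-1 * p^-1)%:E)%E.
Proof.
move=> l1; apply: (@expectation_cycle l (fun h => (hist_aoi h)%:R)) => //.
- apply: measurable_sum_window => [||t]; try exact: measurable_reset_time.
  under eq_fun do rewrite aoiE.
  exact: (measurable_history mU t (fun h => (hist_aoi h)%:R : R)).
- by move=> w _; apply: eq_bigr => t _; rewrite aoiE.
- exact: (cvg_sum_age_occupation update_probability01 l1).
Qed.

Lemma expectation_aoi t :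
  ('E_P[fun w => (aoi beta gamma n k t w)%:R] = (mean_age p t)%:E)%E.
Proof.
rewrite unlock; under eq_integral do rewrite aoiE.
exact: (@integral_history _ _ _ _ _ _ mU PU t (fun h => (hist_aoi h)%:R)).
Qed.

End MeanAge.

(** * Cesaro limit of the mean ages and its identification with the cycle ratios *)

Theorem theorem1 (R : realType) (d : measure_display)
    (Omega : measurableType d) (P : probability Omega R)
    (b : 'I_2 -> 'I_2 -> R) (r : 'I_2 -> R)
    (beta : 'I_2 -> 'I_2 -> 'I_2 -> nat -> {RV P >-> bool})
    (gamma : 'I_2 -> 'I_2 -> nat -> {RV P >-> bool})
    (hpolicy : osr_policy b r)
    (hprocess : osr_process beta gamma b r)
    (hpos : forall n k : 'I_2, 0 < r k * zeta b n k) :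
  cvgn (time_average_aoi beta gamma) /\
  forall l : nat, (1 <= l)%N ->
    (average_aoi beta gamma =
       (4^-1)%:E * \sum_(n < 2) \sum_(k < 2)
         ('E_P[aoi_cycle_sum beta gamma n k l]
          / 'E_P[inter_reset beta gamma n k l]))%E /\
    ((4^-1)%:E * \sum_(n < 2) \sum_(k < 2)
         ('E_P[aoi_cycle_sum beta gamma n k l]
          / 'E_P[inter_reset beta gamma n k l])
     = (4^-1 * \sum_(n < 2) \sum_(k < 2) (r k * zeta b n k)^-1)%R%:E)%E.
Proof.
set L := 4^-1 * \sum_(n < 2) \sum_(k < 2) (r k * zeta b n k)^-1.
have cvgL : time_average_aoi beta gamma @ \oo --> L%:E.
  pose u t := 4^-1 * \sum_(n < 2) \sum_(k < 2) mean_age (r k * zeta b n k) t.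
  have uL : u @ \oo --> L.
    apply: cvgMr; apply: cvg_big => [|n _]; first exact: add_continuous.
    apply: cvg_big => [|k _]; first exact: add_continuous.
    exact/cvg_mean_age/update_probability01.
  have avgE T : time_average_aoi beta gamma T =
      (T%:R^-1 * \sum_(0 <= t < T) u t.+1)%:E.
    rewrite /time_average_aoi big_add1 EFinM; congr (_ * _)%E.
    rewrite -sumEFin; apply: eq_bigr => t _.
    rewrite /u EFinM; congr (_ * _)%E; rewrite -sumEFin; apply: eq_bigr => n _.
    rewrite -sumEFin; apply: eq_bigr => k _.
    exact: (expectation_aoi hprocess).
  (* [arithmetic_mean] at index [T] averages [T.+1] terms, so the time average is shifted by one;
     its value at [T = 0] does not affect the limit. *)
  rewrite -cvg_shiftS; apply: cvg_EFin.
    by apply: nearW => T /=; rewrite avgE.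
  rewrite (_ : _ \o _ = arithmetic_mean (fun t => u t.+1)); last first.
    by apply/funext => T /=; rewrite avgE.
  by apply: cesaro; rewrite cvg_shiftS.
have cycleE l : (1 <= l)%N -> ((4^-1)%:E * \sum_(n < 2) \sum_(k < 2)
         ('E_P[aoi_cycle_sum beta gamma n k l]
          / 'E_P[inter_reset beta gamma n k l]))%E = L%:E.
  move=> l1; rewrite /L EFinM; congr (_ * _)%E.
  rewrite -sumEFin; apply: eq_bigr => n _.
  rewrite -sumEFin; apply: eq_bigr => k _.
  rewrite (expectation_aoi_cycle_sum hpolicy)//.
  rewrite (expectation_inter_reset hpolicy)//.
  (* The mean cycle length is nonzero, so its extended inverse is finite and the ratio of
     [p^-1 * p^-1] to [p^-1], with [p = r k * zeta b n k], is [p^-1]. *)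
  rewrite inver invr_eq0 (gt_eqF (hpos n k)) invrK -EFinM.
  by rewrite divfK// gt_eqF.
split; first by apply/cvg_ex; exists L%:E.
move=> l l1; split; last exact: cycleE.
by rewrite cycleE//; apply/cvg_lim.
Qed.
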